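(* For each ENR $X$, $$\operatorname{TC}_2^S(X)-1\le \operatorname{TC}^{\Sigma}(X)\le \operatorname{TC}_2^S(X).$$
   Context: ENR means euclidean neighborhood retract. Numerical invariants take the value $\infty$ when no finite number as required exists. Let $P(X)$ be the space of continuous paths $[0,1]\to X$ (compact-open topology), and $e_2:P(X)\to X\times X$, $e_2(\gamma)=(\gamma(0),\gamma(1))$. (Here $P(X)$ is identified with the space of maps to $X$ from the wedge of two intervals.) Consider the involutions $\tau(x,y)=(y,x)$ on $X\times X$ and $\overline\tau(\gamma)(t)=\gamma(1-t)$ on $P(X)$. A subset $A\subseteq X\times X$ is symmetric if $\tau A=A$; a map $s:A\to P(X)$ on a symmetric $A$ is equivariant if $\overline\tau(s(a))=s(\tau(a))$ for all $a\in A$. $\operatorname{TC}^{\Sigma}(X)$ is the least integer $k$ such that $X\times X=A_0\cup A_1\cup\cdots\cup A_k$ where each $A_i$ is open, symmetric, and admits a continuous equivariant section $s_i:A_i\to P(X)$ of $e_2$. The Schwarz genus of a map $p:E\to B$ is the least $k$ such that there is an open cover $U_0,\ldots,U_k$ of $B$ and, for each $i$, a continuous map $s_i:U_i\to E$ with $ps_i$ homotopic to the inclusion $U_i\hookrightarrow B$ (for a fibration, equivalently, honest local sections); the genus of the map $\varnothing\to\varnothing$ is $-1$. Let $\mathrm{Conf}_2(X)=\{(x,y)\in X\times X: x\ne y\}$, let $\mathrm{Braid}_2(X)=\mathrm{Conf}_2(X)/\tau$, and let $Y_2(X)=e_2^{-1}(\mathrm{Conf}_2(X))/\overline\tau$.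 The map $e_2$ induces a fibration $\varepsilon_2:Y_2(X)\to \mathrm{Braid}_2(X)$, and $\operatorname{TC}_2^S(X)$ is defined as the Schwarz genus of $\varepsilon_2$ plus $1$. *)

(* Defs.v *)
From HB Require Import structures.
From mathcomp Require Export all_boot all_order all_algebra.
From mathcomp Require Export generic_quotient.
From mathcomp Require Export all_classical all_reals all_analysis.

Set Implicit Arguments.
Unset Strict Implicit.
Unset Printing Implicit Defensive.

Import Order.TTheory GRing.Theory Num.Theory.
Import numFieldNormedType.Exports.

Local Open Scope classical_set_scope.
Local Open Scope ring_scope.
Local Open Scope quotient_scope.

(* A set [A : set X] used as a type is the subtype [set_type A] with the
   subspace topology. *)

Section ENR.
Context (R : realType).

Definition homeomorphic (X Y : topologicalType) : Prop :=
  exists (f : X -> Y) (g : Y -> X),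
    [/\ continuous f, continuous g, cancel f g & cancel g f].

Definition retract_of (T : topologicalType) (U Y : set T) : Prop :=
  Y `<=` U /\
  exists r : U -> Y, continuous r /\
    forall u : U, Y (set_val u) -> set_val (r u) = set_val u.

Definition neighborhood_retract (T : topologicalType) (Y : set T) : Prop :=
  exists U : set T, open U /\ retract_of U Y.

Definition is_ENR (X : topologicalType) : Prop :=
  exists (n : nat) (Y : set 'rV[R]_n),
    neighborhood_retract Y /\ homeomorphic X Y.

End ENR.

(* The least integer k >= -1 such that P (k + 1) holds, and +oo if there is no
   such k; P n is meant to say that some cover by n sets has a given property,
   the members of the cover being numbered 0, ..., k. *)
Definition least_index (P : nat -> Prop) : \bar int :=
  match pselect (exists n, `[< P n >]) with
  | left ex => ((ex_minn ex)%:Z - 1)%:E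
  | right _ => +oo%E
  end.

Section Interval.
Context (R : realType).

Definition unit_interval : set R := `[0, 1].

Lemma unit_interval0 : unit_interval 0.
Proof. by rewrite /unit_interval /= in_itv /= lexx ler01. Qed.

Lemma unit_interval1 : unit_interval 1.
Proof. by rewrite /unit_interval /= in_itv /= lexx ler01. Qed.

Lemma unit_interval_rev (t : unit_interval) : unit_interval (1 - set_val t).
Proof.
have := set_valP t; rewrite /unit_interval /= !in_itv /= => /andP[t0 t1].
by rewrite subr_ge0 t1 lerBlDr lerDl.
Qed.

Definition I0 : unit_interval := SigSub (mem_set unit_interval0).
Definition I1 : unit_interval := SigSub (mem_set unit_interval1).

Definition Irev (t : unit_interval) : unit_interval :=
  SigSub (mem_set (unit_interval_rev t)).

Lemma Irev_continuous : continuous Irev.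
Proof.
apply: (@continuous_comp_initial unit_interval unit_interval R set_val) => t.
rewrite (_ : _ \o _ = fun t : unit_interval => 1 - set_val t)//.
apply: (@cvgB _ R^o _ (nbhs t) _ (cst 1) set_val); first exact: cvg_cst.
exact: initial_continuous.
Qed.

Lemma IrevK : involutive Irev.
Proof. by move=> t; apply: val_inj; rewrite /= subKr. Qed.

Lemma Irev0 : Irev I0 = I1.
Proof. by apply: val_inj; rewrite /= subr0. Qed.

Lemma Irev1 : Irev I1 = I0.
Proof. by apply: val_inj; rewrite /= subrr. Qed.

End Interval.
Arguments unit_interval : clear implicits.
Arguments I0 {R}.
Arguments I1 {R}.

(* p is not assumed to be a fibration, so that the local sections are taken up
   to homotopy. *)
Section SchwarzGenus.
Context (R : realType).
Notation I := (unit_interval R).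

Definition homotopic (S T : topologicalType) (f g : S -> T) : Prop :=
  exists H : S * I -> T,
    [/\ continuous H, forall x, H (x, I0) = f x & forall x, H (x, I1) = g x].

Definition genus_cover (E B : topologicalType) (p : E -> B) (n : nat) : Prop :=
  exists U : 'I_n -> set B,
    [/\ forall i, open (U i),
        \bigcup_i U i = setT
      & forall i, exists s : U i -> E,
          continuous s /\ homotopic (p \o s) (set_val : U i -> B)].

Definition genus (E B : topologicalType) (p : E -> B) : \bar int :=
  least_index (genus_cover p).

End SchwarzGenus.

Section Orbits.
Context (T : topologicalType) (f : T -> T) (fK : involutive f).

Definition orbit_rel : rel T := [rel x y | (y == x) || (y == f x)].

Lemma orbit_rel_refl : reflexive orbit_rel.
Proof. by move=> x; rewrite /orbit_rel /= eqxx. Qed.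

Lemma orbit_rel_sym : symmetric orbit_rel.
Proof.
by move=> x y; rewrite /orbit_rel /= (eq_sym y x) (eq_sym y (f x)) (inv_eq fK).
Qed.

Lemma orbit_rel_trans : transitive orbit_rel.
Proof.
move=> y x z /= /orP[]/eqP-> /orP[]/eqP->; rewrite /orbit_rel /= ?eqxx ?orbT//.
by rewrite fK eqxx.
Qed.

Definition orbit_equiv : equiv_rel T :=
  EquivRel orbit_rel orbit_rel_refl orbit_rel_sym orbit_rel_trans.

Definition orbit_space : topologicalType :=
  quotient_topology {eq_quot orbit_equiv}.

Definition orbit_proj (x : T) : orbit_space := \pi_{eq_quot orbit_equiv} x.

Definition orbit_repr (y : orbit_space) : T :=
  repr (y : {eq_quot orbit_equiv}).

Lemma orbit_projP (x y : T) :
  orbit_proj x = orbit_proj y <-> y = x \/ y = f x.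
Proof.
split=> [/eqmodP/=/orP[]/eqP->|[]->]; [by left|by right|by []|].
by apply/eqmodP; rewrite /= /orbit_rel /= eqxx orbT.
Qed.

Lemma orbit_reprK : cancel orbit_repr orbit_proj.
Proof. by move=> y; exact: reprK. Qed.

End Orbits.

Section TopologicalComplexity.
Context (R : realType) (X : topologicalType).
Notation I := (unit_interval R).

Definition tau (a : X * X) : X * X := (a.2, a.1).

Definition path_space : set {compact-open, I -> X} :=
  [set g | continuous (g : I -> X)].
Notation P := path_space.

Definition eval (g : P) : I -> X := set_val g.

Definition e2 (g : P) : X * X := (eval g I0, eval g I1).

Lemma path_rev_subproof (g : P) : path_space (eval g \o @Irev R).
Proof.
have cg : continuous (eval g) := set_valP g.
by move=> t; apply: continuous_comp; [exact: Irev_continuous|exact: cg].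
Qed.

Definition path_rev (g : P) : P := SigSub (mem_set (@path_rev_subproof g)).

Lemma path_revK : involutive path_rev.
Proof. move=> g; apply/val_inj/funext => t.
by change (eval g (Irev (Irev t)) = eval g t); rewrite IrevK. Qed.

Lemma e2_rev (g : P) : e2 (path_rev g) = tau (e2 g).
Proof.
rewrite /e2 /tau -[eval (path_rev g)]/(eval g \o @Irev R) /=.
by rewrite Irev0 Irev1.
Qed.

Definition symmetric_set (A : set (X * X)) : Prop := tau @` A = A.

Definition equivariant (A : set (X * X)) (s : A -> P) : Prop :=
  forall a b : A, set_val b = tau (set_val a) -> path_rev (s a) = s b.

Definition TCSigma_cover (n : nat) : Prop :=
  exists A : 'I_n -> set (X * X),
    \bigcup_i A i = setT /\
    forall i, [/\ open (A i), symmetric_set (A i) &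
      exists s : A i -> P,
        [/\ continuous s, equivariant s & forall a, e2 (s a) = set_val a]].

Definition TCSigma : \bar int := least_index TCSigma_cover.

Definition Conf2 : set (X * X) := [set a | a.1 <> a.2].

Lemma Conf2_tau (a : Conf2) : Conf2 (tau (set_val a)).
Proof. by move/esym; exact: (set_valP a). Qed.

Definition Conf2_swap (a : Conf2) : Conf2 := SigSub (mem_set (@Conf2_tau a)).

Lemma Conf2_swapK : involutive Conf2_swap.
Proof. by move=> a; apply: val_inj; rewrite /= /tau/= -surjective_pairing. Qed.

Definition Braid2 : topologicalType := orbit_space Conf2_swapK.

Definition Conf2_path : set P := e2 @^-1` Conf2.

Lemma Conf2_path_rev_subproof (g : Conf2_path) :
  Conf2_path (path_rev (set_val g)).
Proof. by rewrite /Conf2_path /= e2_rev => /esym; exact: (set_valP g). Qed.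

Definition Conf2_path_rev (g : Conf2_path) : Conf2_path :=
  SigSub (mem_set (@Conf2_path_rev_subproof g)).

Lemma Conf2_path_revK : involutive Conf2_path_rev.
Proof. by move=> g; apply: val_inj; rewrite /= path_revK. Qed.

Definition Y2 : topologicalType := orbit_space Conf2_path_revK.

Definition Conf2_e2 (g : Conf2_path) : Conf2 :=
  SigSub (mem_set (set_valP g : Conf2 (e2 (set_val g)))).

Definition eps2 (y : Y2) : Braid2 :=
  orbit_proj Conf2_swapK (Conf2_e2 (orbit_repr y)).

Lemma eps2_proj (g : Conf2_path) :
  eps2 (orbit_proj Conf2_path_revK g) = orbit_proj Conf2_swapK (Conf2_e2 g).
Proof.
apply/orbit_projP; have /orbit_projP[] :=
  orbit_reprK (orbit_proj Conf2_path_revK g); set h := orbit_repr _ => ->.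
  by left.
by right; apply: val_inj; rewrite /= e2_rev.
Qed.

Definition TC2S : \bar int := (genus R eps2 + 1)%E.

End TopologicalComplexity.
Arguments path_space : clear implicits.
Arguments Conf2 : clear implicits.
Arguments Conf2_path : clear implicits.

(* Main.v *)
Require Import Defs.
From mathcomp Require Import lra.

(* Lower bound: the restriction of an equivariant section to the configuration
   space descends to a section of [eps2] over the open image in [Braid2].

   Upper bound: let s be a section of [eps2] up to homotopy over an open set U
   of [Braid2], and V the preimage of U in [Conf2].  Since X is Hausdorff, the
   projection from [Conf2] to [Braid2] is a double cover, so the homotopy lifts
   to V, and s lifts to a continuous choice of paths over the far end of the
   lifted homotopy.  Running along the first coordinate of the lift, then along
   the chosen path, then back along the second coordinate, gives an honest
   section over V, and uniqueness of lifts makes it equivariant.  One more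
   symmetric open set is needed to cover the diagonal: the pairs whose straight
   segment stays in a neighbourhood of X retracting onto X. *)

Set Implicit Arguments.
Unset Strict Implicit.
Unset Printing Implicit Defensive.

Import Order.TTheory GRing.Theory Num.Theory.
Import numFieldNormedType.Exports.

Local Open Scope classical_set_scope.
Local Open Scope ring_scope.

(** The offset -1 in [least_index] is common to both sides, so the minimal numbers of sets are
    compared directly. If [P] never holds, the right-hand side is [+oo]. *)
Lemma least_index_le (P Q : nat -> Prop) (k : nat) :
  (forall n, P n -> Q (n + k)%N) ->
  (least_index Q <= least_index P + (k%:Z)%:E)%E.
Proof.
move=> PQ; rewrite /least_index.
case: (pselect (exists n, `[< P n >])) => [exP|nP]; last by rewrite leey.
case: (pselect (exists n, `[< Q n >])) => [exQ|[]]; last first.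
  by have [n /asboolP/PQ Qn] := exP; exists (n + k)%N; exact/asboolP.
case: ex_minnP => m _ minm; case: ex_minnP => n /asboolP/PQ/asboolP/minm mn _.
by rewrite -EFinD lee_fin addrAC lerD2r -PoszD lez_nat.
Qed.

(** * Continuity and subspaces *)

Lemma near_eq_continuous_at (S T : topologicalType) (f g : S -> T) (z : S) :
  (\forall z' \near z, f z' = g z') -> {for z, continuous g} ->
  {for z, continuous f}.
Proof.
move=> fg cg M; rewrite (nbhs_singleton fg) => /cg.
by apply: filterS2 fg => z' /= ->.
Qed.

Lemma pair_continuous_at (S A B : topologicalType) (f : S -> A) (g : S -> B)
    (z : S) :
  {for z, continuous f} -> {for z, continuous g} ->
  {for z, continuous (fun x => (f x, g x))}.
Proof.
move=> cf cg.
exact: (@cvg_pair _ _ _ (nbhs z) (nbhs (f z)) (nbhs (g z))).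
Qed.

Lemma set_val_continuous (T : topologicalType) (A : set T) :
  continuous (set_val : A -> T).
Proof. exact: initial_continuous. Qed.

Lemma set_val_surj (T : Type) (A : set T) x :
  A x -> exists a : A, set_val a = x.
Proof. by move=> Ax; exists (SigSub (mem_set Ax)). Qed.

Definition corestrict (S T : Type) (A : set T) (h : S -> T)
  (hA : forall x, A (h x)) (x : S) : A := SigSub (mem_set (hA x)).

Lemma corestrict_continuous (S T : topologicalType) (A : set T) (h : S -> T)
  (hA : forall x, A (h x)) : continuous h -> continuous (corestrict hA).
Proof. by move=> ch; apply: continuous_comp_initial. Qed.

Lemma open_image_set_val (T : topologicalType) (A : set T) (W : set A) :
  open A -> open W -> open (set_val @` W).
Proof.
move=> oA [G oG GW]; rewrite (_ : _ @` _ = A `&` G); first exact: openI.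
rewrite -GW eqEsubset; split=> [x [w /= Gw <-]|x [Ax Gx]].
  by split=> //; exact: (set_valP w).
by exists (SigSub (mem_set Ax)).
Qed.

Lemma continuous_inj_hausdorff (S T : topologicalType) (f : S -> T) :
  continuous f -> injective f -> hausdorff_space T -> hausdorff_space S.
Proof.
move=> cf injf hT x y xy; apply/injf/hT => M N /cf Mx /cf Ny.
by have [z [Mz Nz]] := xy _ _ Mx Ny; exists (f z).
Qed.

(** Off the level set [phi z = c] one branch is in force locally. On it [h] and [k] have the same
    value, so near such a point both stay in a given neighbourhood of that value, whichever branch
    is taken. *)
Lemma glue_continuous (R : realType) (Z X : topologicalType) (phi : Z -> R)
    (c : R) (h k : Z -> X) :
  continuous phi -> continuous h -> continuous k ->
  (forall z, phi z = c -> h z = k z) ->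
  continuous (fun z => if phi z <= c then h z else k z).
Proof.
move=> cphi ch ck hk; set F := (X in continuous X) => z.
have [zc|zc|zc] := ltgtP (phi z) c.
- apply: (@near_eq_continuous_at _ _ _ h); last exact: ch.
  have : \forall z' \near z, phi z' < c by exact: cphi z _ (lt_nbhsl zc).
  by apply: filterS => z' /ltW z'c; rewrite /F z'c.
- apply: (@near_eq_continuous_at _ _ _ k); last exact: ck.
  have : \forall z' \near z, c < phi z' by exact: cphi z _ (lt_nbhsr zc).
  apply: filterS => z'.
  by rewrite ltNge /F => /negbTE ->.
- move=> M; rewrite {1}/F zc lexx => Mz.
  have Mkz : nbhs (k z) M by rewrite -hk.
  have : \forall z' \near z, M (h z') by exact: ch.
  have : \forall z' \near z, M (k z') by exact: ck.
  by apply: filterS2 => z' Mk Mh; rewrite /F/=; case: ifP.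
Qed.

(** * Orbit spaces of involutions *)

Section OrbitSpace.
Context (T : topologicalType) (f : T -> T) (fK : involutive f).
Hypothesis cf : continuous f.
Notation q := (orbit_proj fK).

Lemma orbit_proj_continuous : continuous q.
Proof. exact: pi_continuous. Qed.

Lemma orbit_proj_fixed x : q (f x) = q x.
Proof. by apply/orbit_projP; right; rewrite fK. Qed.

(** The quotient topology asks for the saturation of [N] to be open; for an involution this is a
    union of two open sets. *)
Lemma open_orbit_proj (N : set T) : open N -> open (q @` N).
Proof.
move=> oN; change (open (q @^-1` (q @` N))).
rewrite (_ : _ @^-1` _ = N `|` f @^-1` N).
  by apply: openU => //; move/continuousP: cf; apply.
rewrite eqEsubset; split=> x /=.
  by move=> [y Ny] /orbit_projP[]->; [left|right; rewrite /= fK].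
move=> [Nx|Nx]; first by exists x.
by exists (f x) => //; apply/orbit_projP; right; rewrite fK.
Qed.

Lemma nbhs_orbit_proj (x : T) (N : set T) : nbhs x N -> nbhs (q x) (q @` N).
Proof.
rewrite nbhsE => -[G [oG Gx] GN]; rewrite nbhsE; exists (q @` G).
  by split; [exact: open_orbit_proj|exists x].
exact: image_subset.
Qed.

Definition separated_from_image (N : set T) := forall x, N x -> ~ N (f x).

Lemma separated_orbit_inj (N : set T) x y : separated_from_image N ->
  N x -> N y -> q x = q y -> x = y.
Proof.
move=> sepN Nx Ny /orbit_projP[->//|yfx].
by case: (sepN x Nx); rewrite -yfx.
Qed.

(* A neighbourhood disjoint from its image under [f] is evenly covered, so it
   suffices to know which of the two sheets the lift lies in. *)
Lemma lift_continuous_at (Z : topologicalType) (L : Z -> T) (z : Z)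
    (N : set T) :
  {for z, continuous (q \o L)} -> separated_from_image N -> nbhs (L z) N ->
  (\forall z' \near z, N (L z')) -> {for z, continuous L}.
Proof.
move=> cqL sepN nN NL M LzM.
apply: filterS2 NL (cqL _ (nbhs_orbit_proj (filterI nN LzM))).
move=> z' NL [y [Ny My]] /(separated_orbit_inj sepN Ny NL) yL.
by rewrite /= -yL.
Qed.

(** Since the projection is open, its restriction over the open set [U] is again a quotient map, so
    a map constant on orbits descends there. *)
Lemma orbit_descent (Y : topologicalType) (U : set (orbit_space fK))
    (h : q @^-1` U -> Y) : open U -> continuous h ->
  (forall a b, q (set_val a) = q (set_val b) -> h a = h b) ->
  exists s : U -> Y, continuous s /\
    forall a u, q (set_val a) = set_val u -> s u = h a.
Proof.
move=> oU /continuousP ch hq.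
have reprU (u : U) : (q @^-1` U) (orbit_repr (set_val u)).
  by rewrite /= orbit_reprK; exact: (set_valP u).
pose s u := h (corestrict reprU u).
have sE a u : q (set_val a) = set_val u -> s u = h a.
  by move=> au; apply: hq; rewrite /= orbit_reprK.
exists s; split => //; apply/continuousP => M /ch[G oG GM].
exists (q @` (G `&` (q @^-1` U))).
  apply: open_orbit_proj => //; apply: openI => //; exact: oU.
rewrite eqEsubset; split=> u /=.
  move=> [x [Gx Ux] xu].
  have [a xa] := set_val_surj (Ux : (q @^-1` U) x).
  by rewrite (sE a u) ?xa//; change ((h @^-1` M) a); rewrite -GM /= xa.
move=> Msu; have : (h @^-1` M) (corestrict reprU u) by [].
rewrite -GM => Gu.
exists (orbit_repr (set_val u)); last exact: orbit_reprK.
by split => //; exact: reprU.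
Qed.

End OrbitSpace.

(** * The unit interval *)

Section UnitInterval.
Context (R : realType).

(** The step is applied at the supremum of the [t <= 1] satisfying [P]: it reaches beyond the
    supremum, hence beyond 1. Starting from any [t] in a window ending at [t0], it serves limit and
    successor stages at once. *)
Lemma real_induction (P : R -> Prop) : P 0 ->
  (forall t0, 0 <= t0 -> exists2 e, 0 < e &
    forall t, t0 - e < t <= t0 -> P t -> P (t0 + e)) ->
  exists2 t, 1 < t & P t.
Proof.
move=> P0 step; pose S := [set t | P t /\ t <= 1].
have S0 : S 0 by split.
have supS : has_sup S by split; [exists 0|exists 1 => t []].
have [e e0 He] := step _ (ub_le_sup supS.2 S0).
have [t St lt] := sup_adherent e0 supS.
have Pt : P (sup S + e).
  by apply: (He t) St.1; rewrite lt (ub_le_sup supS.2).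
exists (sup S + e) => //; rewrite ltNge; apply/negP => le1.
have : sup S + e <= sup S by apply: (ub_le_sup supS.2).
by rewrite gerDl leNgt e0.
Qed.

Lemma clamp_subproof (t : R) : unit_interval R (Num.max 0 (Num.min t 1)).
Proof.
rewrite /unit_interval/= in_itv/= le_max lexx/= ge_max ler01/=.
by rewrite ge_min lexx orbT.
Qed.

(** Retraction of the line onto the interval. Precomposing with it turns paths into functions of a
    real time, constant outside the interval, and lets affine reparametrisations overshoot. *)
Definition clamp (t : R) : unit_interval R :=
  SigSub (mem_set (clamp_subproof t)).

Lemma clamp_continuous : continuous clamp.
Proof.
apply: continuous_comp_initial => t.
apply: (@continuous_max R R (cst 0) (id \min cst 1)); first exact: cvg_cst.
by apply: continuous_min; [exact: cvg_id|exact: cvg_cst].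
Qed.

Lemma clampK (t : unit_interval R) : clamp (set_val t) = t.
Proof.
apply: val_inj => /=; have := set_valP t.
by rewrite /unit_interval/= in_itv/= => /andP[t0 t1]; rewrite min_l// max_r.
Qed.

Lemma clamp_le0 t : t <= 0 -> clamp t = I0.
Proof.
by move=> t0; apply: val_inj; rewrite /= min_l ?max_l// (le_trans t0).
Qed.

Lemma clamp_ge1 t : 1 <= t -> clamp t = I1.
Proof. by move=> t1; apply: val_inj; rewrite /= min_r// max_r. Qed.

Lemma clamp_rev (t : R) : clamp (1 - t) = Irev (clamp t).
Proof.
have [t0|t0] := leP t 0; first by rewrite clamp_ge1 ?clamp_le0 ?Irev0//; lra.
have [t1|t1] := leP 1 t; first by rewrite clamp_le0 ?clamp_ge1 ?Irev1//; lra.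
have tE : set_val (clamp t) = t.
  by change (Num.max 0 (Num.min t 1) = t); rewrite min_l ?max_r// ltW.
by apply: val_inj; rewrite [RHS]/= tE /= min_l ?max_r//; lra.
Qed.

Lemma unit_interval_compact : compact [set: unit_interval R].
Proof.
rewrite (_ : setT = clamp @` `[0, 1]); last first.
  apply/esym; rewrite -subTset => t _; exists (set_val t); last exact: clampK.
  exact: (set_valP t).
apply: continuous_compact; last exact: segment_compact.
by apply: continuous_subspaceT; exact: clamp_continuous.
Qed.

Lemma unit_interval_hausdorff : hausdorff_space (unit_interval R).
Proof.
apply: (@continuous_inj_hausdorff _ _ set_val).
- exact: set_val_continuous.
- exact: val_inj.
- exact: Rhausdorff.
Qed.

Lemma unit_interval_locally_compact : locally_compact [set: unit_interval R].
Proof.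
move=> t _; exists setT; first exact: filterT.
by split; [exact: unit_interval_compact|exact: closedT].
Qed.

End UnitInterval.

(** * Homotopy lifting for double covers *)

Section Lifting.
Context (R : realType) (T : topologicalType) (f : T -> T) (fK : involutive f).
Hypothesis cf : continuous f.
Hypothesis sep : forall x : T, exists2 N, open_nbhs x N &
  separated_from_image f N.
Notation q := (orbit_proj fK).
Notation I := (unit_interval R).

Lemma separated_preimage N : separated_from_image f N ->
  separated_from_image f (f @^-1` N).
Proof. by move=> sepN x Nfx; exact: sepN. Qed.

(** Induction along the line on the time up to which the lifts agree. At [t0] they lie over the same
    point, hence either coincide or are exchanged by [f]. *)
Lemma lift_unique (a b : I -> T) : continuous a -> continuous b ->
  (forall t, q (a t) = q (b t)) -> a I0 = b I0 -> a = b.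
Proof.
move=> ca cb qab ab0.
have cac : continuous (a \o @clamp R).
  by move=> t; apply: continuous_comp; [exact: clamp_continuous|exact: ca].
have cbc : continuous (b \o @clamp R).
  by move=> t; apply: continuous_comp; [exact: clamp_continuous|exact: cb].
pose P t := forall s, s <= t -> a (clamp s) = b (clamp s).
have [||t t1 Pt] := @real_induction R P.
- by move=> s s0; rewrite clamp_le0.
- move=> t0 t0ge; have [N /open_nbhs_nbhs nN sepN] := sep (a (clamp t0)).
  have Na : \forall s \near t0, N (a (clamp s)) by exact: cac.
  have /orbit_projP[bE|bE] := qab (clamp t0).
    have : \forall s \near t0, N (b (clamp s)).
      by apply: cbc; rewrite /= bE.
    move/(filterI Na)/nbhs_ballP => [e /= e0 He].
    (* Half the radius, because agreement is claimed at the end point [t0 + e / 2] too, which must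
       lie in the open ball. *)
    exists (e / 2); first by rewrite divr_gt0.
    move=> t /andP[tgt _] Pt s sle.
    have [|st] := leP s t; first exact: Pt.
    have [] := He s.
      rewrite /ball/= ltr_distlC; apply/andP; split; lra.
    by move=> Nas Nbs; exact: (separated_orbit_inj sepN Nas Nbs (qab _)).
  (* Opposite sheets at [t0]: near [t0] both [a] and [f \o b] lie in [N], so [a] and [b] differ
     there, against [P t] for [t] close to [t0]. *)
  have : \forall s \near t0, N (f (b (clamp s))).
    have cfb : {for t0, continuous (f \o (b \o @clamp R))}.
      by apply: continuous_comp; [exact: cbc|exact: cf].
    by apply: cfb; rewrite /= bE fK.
  move/(filterI Na)/nbhs_ballP => [e /= e0 He].
  exists e => // t /andP[tgt tle] Pt.
  have [] := He t; first by rewrite /ball/= ltr_distlC; apply/andP; split; lra.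
  by move=> /sepN Nat; rewrite -(Pt t (lexx _)) => /Nat.
apply/funext => s; rewrite -(clampK s); apply: Pt.
have := set_valP s; rewrite /unit_interval/= in_itv/= => /andP[_ s1].
exact: le_trans s1 (ltW t1).
Qed.

Section Existence.
Context (V : topologicalType).

Section Local.
Context (F : V * R -> orbit_space fK) (g : V -> T).
Hypothesis cF : continuous F.
Hypothesis cg : continuous g.
Hypothesis Fg : forall v s, s <= 0 -> F (v, s) = q (g v).

(* The lift is total and merely continuous in the range of interest, which
   avoids one-sided continuity at the end points of the range. *)
Definition lifted_up_to (v : V) (t : R) := exists (N : set V) (L : V * R -> T),
  [/\ nbhs v N, forall z, q (L z) = F z,
      forall w s, N w -> s <= 0 -> L (w, s) = g w
    & forall w s, N w -> s < t -> {for (w, s), continuous L}].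

Lemma lift_near (L : V * R -> T) w s (N : set T) :
  (forall z, q (L z) = F z) ->
  open_nbhs (L (w, s)) N -> separated_from_image f N ->
  (\forall z \near (w, s), N (L z)) -> {for (w, s), continuous L}.
Proof.
move=> qL /open_nbhs_nbhs nN sepN NL.
apply: (lift_continuous_at cf _ sepN) => //.
by rewrite (_ : _ \o _ = F); [exact: cF|exact/funext].
Qed.

Lemma lifted_up_to0 v : lifted_up_to v 0.
Proof.
(* After time 0 arbitrary representatives suffice, as continuity is asked only for negative
   times. *)
pose L (z : V * R) := if z.2 <= 0 then g z.1 else orbit_repr (F z).
have qL z : q (L z) = F z.
  case: z => w s; rewrite /L/=; case: ifPn => [s0|_]; first by rewrite Fg.
  exact: orbit_reprK.
exists setT, L; split => // [|w s _ s0|w s _ s0]; first exact: filterT.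
  by rewrite /L/= s0.
have [N nN sepN] := sep (L (w, s)).
apply: (lift_near qL nN sepN).
have nNg : nbhs w (g @^-1` N).
  by apply: cg; move: (open_nbhs_nbhs nN); rewrite /L/= ltW.
exists (g @^-1` N, [set s | s < 0]); first by split=> //=; exact: lt_nbhsl.
by move=> [w' s'] [/= Nw' s'0]; rewrite /L/= ltW.
Qed.

(** On a box [A] x [B] around [(v, t0)] the map [F] stays in the image of one sheet. A lift that has
    entered the box can be continued inside the sheet it has reached. *)
Lemma lifted_step v t0 : 0 <= t0 -> exists2 e, 0 < e &
  forall t, t0 - e < t <= t0 -> lifted_up_to v t -> lifted_up_to v (t0 + e).
Proof.
move=> t0ge; have [N0 nN0 sepN0] := sep (orbit_repr (F (v, t0))).
have : nbhs (v, t0) (F @^-1` (q @` N0)).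
  have := nbhs_orbit_proj fK cf (open_nbhs_nbhs nN0).
  by rewrite orbit_reprK; exact: cF.
move=> [[A B] [/= nA /nbhs_ballP[e /= e0 Be]] ABF].
exists e => // t /andP[tgt tle] [N [L [nN qL Lg cL]]].
(* [L] is kept up to time [t1] and continued inside the sheet [N1] after it. *)
pose t1 := (t0 - e + t) / 2.
have t1t : t1 < t by rewrite /t1; lra.
have t1e : t0 - e < t1 by rewrite /t1; lra.
have inB s : t0 - e < s -> s < t0 + e -> B s.
  move=> s1 s2; apply: Be.
  by rewrite /ball/= ltr_distlC; apply/andP; split; lra.
have Av : A v by exact: nbhs_singleton.
have Nv : N v by exact: nbhs_singleton.
have Bt1 : B t1 by apply: inB; lra.
(* [N1] is [N0] or its preimage under [f], whichever contains [L (v, t1)]. *)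
have [N1 [oN1 sepN1 N1L N1F]] : exists N1,
    [/\ open N1, separated_from_image f N1, N1 (L (v, t1)) &
      forall z, F z \in q @` N0 -> exists2 y, N1 y & q y = F z].
  have /= [y N0y] := ABF (v, t1) (conj Av Bt1).
  rewrite -qL => /orbit_projP[Ly|Ly].
    exists N0; split => //; [exact: nN0.1|by rewrite Ly|].
    by move=> z /set_mem[x N0x qx]; exists x.
  exists (f @^-1` N0); split => //; last 2 first.
  - by rewrite /= Ly fK.
  - move=> z /set_mem[x N0x <-]; exists (f x); first by rewrite /= fK.
    exact: orbit_proj_fixed.
  - by move/continuousP: cf; apply; exact: nN0.1.
  - exact: separated_preimage.
(* [l] is the inverse of the projection on the sheet [N1], completed by arbitrary representatives
   elsewhere. *)
have /choice[l lP] z : exists y, q y = F z /\ (F z \in q @` N0 -> N1 y).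
  have [/N1F[y N1y qy]|Nz] := boolP (F z \in q @` N0); first by exists y.
  by exists (orbit_repr (F z)); split=> //; exact: orbit_reprK.
have N1l w s : A w -> B s -> N1 (l (w, s)).
  by move=> Aw Bs; apply: (lP _).2; apply/mem_set; exact: (ABF (w, s)).
pose L' z := if z.2 <= t1 then L z else l z.
have qL' z : q (L' z) = F z by rewrite /L'; case: ifP => // _; exact: (lP z).1.
have nN1 : nbhs (v, t1) (L @^-1` N1).
  exact: (cL v t1 Nv t1t _ (open_nbhs_nbhs (conj oN1 N1L))).
(* For [w] near [v] the old lift at time [t1] lies in the same sheet, so that the two pieces fit
   together. *)
have nN1v : \forall w \near v, N1 (L (w, t1)).
  have c1 : {for v, continuous (fun w : V => (w, t1))}.
    by apply: pair_continuous_at; [exact: cvg_id|exact: cvg_cst].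
  exact: (c1 _ nN1).
(* The interior is taken because continuity at [(w, s)] requires [A] to be a neighbourhood of [w],
   not only of [v]. *)
exists (N `&` A° `&` [set w | N1 (L (w, t1))]), L'; split => //.
- by apply: filterI => //; apply: filterI => //; exact: nbhs_interior.
(* [t1] may be negative, and then [l] is in force at some [s <= 0]. There [F (w, s)] and [F (w, t1)]
   are both [q (g w)], and the sheet contains only one point over it. *)
- move=> w s [[Nw /nbhs_singleton Aw] N1w] s0; rewrite /L'/=.
  case: ifPn => [_|]; first exact: Lg.
  rewrite -ltNge => t1s.
  rewrite -(Lg w t1 Nw (ltW (lt_le_trans t1s s0))).
  apply: (separated_orbit_inj sepN1) => //.
    by apply: N1l => //; apply: inB; lra.
  by rewrite qL (lP _).1 !Fg// (ltW (lt_le_trans t1s s0)).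
- move=> w s [[Nw Aw] N1w] st.
  have [st1|t1s|->] := ltgtP s t1.
  + apply: (@near_eq_continuous_at _ _ _ L); last exact: cL (lt_trans st1 t1t).
    exists (setT, [set s | s < t1]).
      by split; [exact: filterT|exact: lt_nbhsl].
    by move=> [w' s'] [_ /= s't1]; rewrite /L'/= ltW.
  + have N1L' : \forall z \near (w, s), N1 (L' z).
      exists (A, [set s | t1 < s] `&` [set s | s < t0 + e]).
        split => //=; apply: filterI; [exact: lt_nbhsr|exact: lt_nbhsl].
      move=> [w' s'] [/= Aw' [t1s' s't0]]; rewrite /L'/= leNgt t1s'/=.
      by apply: N1l => //; apply: inB => //; lra.
    apply: (lift_near qL' _ sepN1) => //.
    by split => //; exact: nbhs_singleton N1L'.
  (* At the junction both pieces stay in [N1], the old one by continuity and the new one by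
     construction, so the glued lift is continuous. *)
  + apply: (lift_near qL' _ sepN1); first by split => //; rewrite /L'/= lexx.
    have : nbhs (w, t1) (L @^-1` N1).
      exact: (cL w t1 Nw t1t _ (open_nbhs_nbhs (conj oN1 N1w))).
    have : nbhs (w, t1) [set z : V * R | A z.1 /\ B z.2].
      exists (A, [set s | t0 - e < s] `&` [set s | s < t0 + e]).
        by split => //=; apply: filterI; [exact: lt_nbhsr|apply: lt_nbhsl; lra].
      by move=> [w' s'] [/= Aw' [s1 s2]]; split => //; exact: inB.
    apply: filterS2 => -[w' s'] [/= Aw' Bs'] N1w'.
    by rewrite /L'/=; case: ifP => // _; exact: N1l.
Qed.

Lemma lifted_up_to_gt1 v : exists2 t, 1 < t & lifted_up_to v t.
Proof.
by apply: real_induction; [exact: lifted_up_to0|move=> t0; exact: lifted_step].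
Qed.

End Local.

(** Clamping the time makes the homotopy constant before 0 and after 1, and lifting past 1 gives
    ordinary continuity at the end. The local lifts agree on overlaps by uniqueness of lifted
    paths. *)
Lemma homotopy_lifting (F : V * I -> orbit_space fK) (g : V -> T) :
  continuous F -> continuous g -> (forall v, F (v, I0) = q (g v)) ->
  exists G : V * I -> T, [/\ continuous G, forall z, q (G z) = F z
    & forall v, G (v, I0) = g v].
Proof.
move=> cF cg Fg; pose F' (z : V * R) := F (z.1, clamp z.2).
have cF' : continuous F'.
  move=> z; apply: (@continuous_comp _ _ _ (fun z : V * R => (z.1, clamp z.2))).
    apply: pair_continuous_at; first exact: cvg_fst.
    by apply: continuous_comp; [exact: cvg_snd|exact: clamp_continuous].
  exact: cF.
have Fg' v s : s <= 0 -> F' (v, s) = q (g v).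
  by move=> s0; rewrite /F'/= clamp_le0.
have /choice[NL NLP] (v : V) : exists NL : set V * (V * R -> T),
    [/\ nbhs v NL.1, forall z, q (NL.2 z) = F' z,
        forall w s, NL.1 w -> s <= 0 -> NL.2 (w, s) = g w
      & forall w s, NL.1 w -> s <= 1 -> {for (w, s), continuous NL.2}].
  have [t t1 [N [L [nN qL Lg cL]]]] := lifted_up_to_gt1 cF' cg Fg' v.
  exists (N, L); split => //= w s Nw s1; apply: cL => //; exact: le_lt_trans t1.
have I01 (t : I) : set_val t <= 1.
  by have := set_valP t; rewrite /unit_interval/= in_itv/= => /andP[].
have cval (t : I) : {for t, continuous (set_val : I -> R)}.
  exact: initial_continuous.
have cpath (v w : V) : (NL v).1 w ->
    continuous (fun t : I => (NL v).2 (w, set_val t)).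
  move=> Nw t; apply: (@continuous_comp _ _ _ (fun t : I => (w, set_val t))).
    by apply: pair_continuous_at; [exact: cst_continuous|exact: cval].
  by have [_ _ _] := NLP v; apply.
(* Each point uses the lift chosen for itself; [GE] identifies this near [v] with the single lift
   chosen for [v], which gives continuity. *)
pose G (z : V * I) := (NL z.1).2 (z.1, set_val z.2).
have GE (v w : V) t : (NL v).1 w -> G (w, t) = (NL v).2 (w, set_val t).
  move=> Nw; have Nww : (NL w).1 w by have [/nbhs_singleton] := NLP w.
  have := @lift_unique _ _ (cpath _ _ Nww) (cpath _ _ Nw).
  move/(_ _ _)/(congr1 (fun h => h t)); apply.
    by move=> s; have [_ -> _ _] := NLP w; have [_ -> _ _] := NLP v.
  have [_ _ -> //] := NLP w; by have [_ _ -> //] := NLP v.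
exists G; split.
- move=> [v t]; have [nN _ _ cN] := NLP v.
  apply: (@near_eq_continuous_at _ _ _
    (fun z : V * I => (NL v).2 (z.1, set_val z.2))).
    exists ((NL v).1, setT); first by split => //; exact: filterT.
    by move=> [w s] [/= Nw _]; exact: GE.
  apply: (@continuous_comp _ _ _ (fun z : V * I => (z.1, set_val z.2))).
    apply: pair_continuous_at; first exact: cvg_fst.
    by apply: continuous_comp; [exact: cvg_snd|exact: cval].
  by apply: cN => //; exact: nbhs_singleton.
- by move=> [v t]; rewrite /G; have [_ -> _ _] := NLP v; rewrite /F'/= clampK.
- by move=> v; rewrite /G/=; have [/nbhs_singleton Nv _ -> //] := NLP v.
Qed.

End Existence.

End Lifting.

(** * Path spaces *)

Section PathSpace.
Context (R : realType) (X : topologicalType).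
Notation I := (unit_interval R).
Notation P := (path_space R X).

Lemma eval_continuous : continuous (fun z : P * I => Defs.eval z.1 z.2).
Proof.
rewrite (_ : (fun z => _) = uncurry (@Defs.eval R X)); last first.
  by apply/funext => -[].
apply: continuous_uncurry.
- exact: unit_interval_locally_compact.
- exact: unit_interval_hausdorff.
- exact: set_val_continuous.
- by move=> g; exact: (set_valP g).
Qed.

Lemma continuous_to_paths (Z : topologicalType) (h : Z * I -> X) :
  continuous h ->
  exists s : Z -> P, continuous s /\ forall z t, Defs.eval (s z) t = h (z, t).
Proof.
move=> /continuous_curry[ch chz].
have hP z : path_space R X (curry h z) by exact: chz.
by exists (corestrict hP); split => //; exact: corestrict_continuous.
Qed.

Lemma eval_at_continuous (Z : topologicalType) (g : Z -> P) (t : Z -> I) :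
  continuous g -> continuous t -> continuous (fun z => Defs.eval (g z) (t z)).
Proof.
move=> cg ct z.
apply: (@continuous_comp _ _ _ (fun z => (g z, t z))
  (fun z : P * I => Defs.eval z.1 z.2)).
  by apply: pair_continuous_at; [exact: cg|exact: ct].
exact: eval_continuous.
Qed.

Lemma path_rev_continuous : continuous (@path_rev R X).
Proof.
apply: continuous_comp_initial.
apply: (@continuous_curry_fun P I X (fun z => Defs.eval z.1 (Irev z.2))).
apply: eval_at_continuous => z; first exact: cvg_fst.
by apply: continuous_comp; [exact: cvg_snd|exact: Irev_continuous].
Qed.

Lemma e2_continuous : continuous (@e2 R X).
Proof.
have cev (t : I) : continuous (fun g : P => Defs.eval g t).
  by apply: (@eval_at_continuous _ id (fun=> t)) => g;
    [exact: cvg_id|exact: cst_continuous].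
move=> g; apply: (@pair_continuous_at _ _ _ (fun g : P => Defs.eval g I0)
  (fun g : P => Defs.eval g I1)); exact: cev.
Qed.

End PathSpace.

(** * Configuration spaces *)

Section Configuration.
Context (R : realType) (X : topologicalType).
Notation I := (unit_interval R).
Notation P := (path_space R X).

(** The three ranges are closed, so a path and its reverse can be compared piece by piece without
    treating the break points separately. *)
Lemma concatenate3 (Z : topologicalType) (p1 p2 p3 : Z * I -> X) :
  continuous p1 -> continuous p2 -> continuous p3 ->
  (forall z t, set_val t = 1 / 3 -> p1 (z, t) = p2 (z, t)) ->
  (forall z t, set_val t = 2 / 3 -> p2 (z, t) = p3 (z, t)) ->
  exists h : Z * I -> X, [/\ continuous h,
    forall z t, set_val t <= 1 / 3 -> h (z, t) = p1 (z, t),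
    forall z t, 1 / 3 <= set_val t <= 2 / 3 -> h (z, t) = p2 (z, t) &
    forall z t, 2 / 3 <= set_val t -> h (z, t) = p3 (z, t)].
Proof.
move=> c1 c2 c3 p12 p23.
have cval : continuous (fun z : Z * I => set_val z.2).
  by move=> z; apply: continuous_comp; [exact: cvg_snd|
    exact: set_val_continuous].
pose p12' z := if set_val z.2 <= 1 / 3 :> R then p1 z else p2 z.
have c12 : continuous p12'.
  by apply: glue_continuous => // -[z t]; exact: p12.
exists (fun z => if set_val z.2 <= 2 / 3 :> R then p12' z else p3 z); split.
- apply: glue_continuous => // -[z t] /= t23; rewrite /p12'/= t23.
  by rewrite ifF ?p23//; apply/negbTE; rewrite -ltNge; lra.
- by move=> z t t1; rewrite /p12'/= t1 ifT//; lra.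
- move=> z t /andP[t1 t2]; rewrite /p12'/= t2; case: ifPn => // t1'.
  by apply: p12; apply/eqP; rewrite eq_le t1'.
- move=> z t t2; rewrite /p12'/=; case: ifPn => // t2'.
  rewrite ifF; last by apply/negbTE; rewrite -ltNge; lra.
  by apply: p23; apply/eqP; rewrite eq_le t2'.
Qed.

Lemma tau_continuous : continuous (@tau X).
Proof.
by move=> a; apply: pair_continuous_at; [exact: cvg_snd|exact: cvg_fst].
Qed.

Lemma Conf2_swap_continuous : continuous (@Conf2_swap X).
Proof.
apply: (@corestrict_continuous _ _ _ _ (@Conf2_tau X)) => a.
by apply: continuous_comp; [exact: set_val_continuous|exact: tau_continuous].
Qed.

Lemma Conf2_path_rev_continuous : continuous (@Conf2_path_rev R X).
Proof.
apply: (@corestrict_continuous _ _ _ _ (@Conf2_path_rev_subproof R X)) => g.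
by apply: continuous_comp; [exact: set_val_continuous|
  exact: path_rev_continuous].
Qed.

Lemma Conf2_e2_continuous : continuous (@Conf2_e2 R X).
Proof.
apply: (@corestrict_continuous _ _ _ _
  (fun g : Conf2_path R X => set_valP g : Conf2 X (e2 (set_val g)))) => g.
by apply: continuous_comp; [exact: set_val_continuous|exact: e2_continuous].
Qed.

Lemma Conf2_e2_rev (g : Conf2_path R X) :
  Conf2_e2 (Conf2_path_rev g) = Conf2_swap (Conf2_e2 g).
Proof. by apply: val_inj; rewrite /= e2_rev. Qed.

Lemma Conf2_swap_neq (c : Conf2 X) : Conf2_swap c <> c.
Proof.
move=> cc; have := set_valP c; rewrite /Conf2/=; apply.
by have := congr1 (fun c : Conf2 X => (set_val c).2) cc.
Qed.

Section Hausdorff.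
Hypothesis hX : hausdorff_space X.

(** Disjoint neighbourhoods of the two coordinates have as product a sheet that the swap moves off
    itself. *)
Lemma Conf2_separated (c : Conf2 X) :
  exists2 N, open_nbhs c N & separated_from_image (@Conf2_swap X) N.
Proof.
have xy : (set_val c).1 != (set_val c).2 by apply/eqP; exact: (set_valP c).
have := hX; rewrite open_hausdorff => /(_ _ _ xy).
move=> [[A B] [/= /set_mem Ax /set_mem By] [oA oB /eqP AB]].
have cfst : continuous (fun d : Conf2 X => (set_val d).1).
  by move=> d; apply: continuous_comp; [exact: set_val_continuous|
    exact: cvg_fst].
have csnd : continuous (fun d : Conf2 X => (set_val d).2).
  by move=> d; apply: continuous_comp; [exact: set_val_continuous|
    exact: cvg_snd].
exists ([set d | A (set_val d).1] `&` [set d | B (set_val d).2]).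
  by split => //; apply: openI; [move/continuousP: cfst|move/continuousP: csnd];
    exact.
move=> d [/= Ad _] [_ Bd]; have : (A `&` B) (set_val d).1 by split.
by rewrite AB.
Qed.

Lemma open_Conf2 : open (Conf2 X).
Proof.
rewrite openE => a /eqP a12.
have := hX; rewrite open_hausdorff => /(_ _ _ a12).
move=> [[A B] [/= /set_mem Ax /set_mem By] [oA oB /eqP AB]].
exists (A, B); first by split; exact: open_nbhs_nbhs.
move=> [x y] [/= Axx Byy] /= xy; have : (A `&` B) x.
  by split => //; move: xy => /= ->.
by rewrite AB.
Qed.

End Hausdorff.

Lemma genus_cover_TCSigma n :
  TCSigma_cover R X n -> genus_cover R (@eps2 R X) n.
Proof.
move=> [A [coverA AP]].
pose q := orbit_proj (@Conf2_swapK X).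
pose W i : set (Conf2 X) := [set c | A i (set_val c)].
(* Symmetry of [A i] makes [W i] saturated, so [s] is available on the whole preimage of its
   image. *)
have qW i c : (q @` W i) (q c) -> A i (set_val c).
  move=> [d Wd] /orbit_projP[->//|->].
  by have [_ symA _] := AP i; rewrite -symA; exists (set_val d).
have oU i : open (q @` W i).
  apply: open_orbit_proj; first exact: Conf2_swap_continuous.
  have [oA _ _] := AP i.
  by move/continuousP: (@set_val_continuous _ (Conf2 X)); apply.
exists (fun i => q @` W i); split => //.
  rewrite -subTset => b _; have : setT (set_val (orbit_repr b)) by [].
  rewrite -coverA => -[i _ Ab]; exists i => //; exists (orbit_repr b) => //.
  exact: orbit_reprK.
move=> i; have [_ _ [s [cs eqs e2s]]] := AP i.
have WA (c : q @^-1` (q @` W i)) : A i (set_val (set_val c)).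
  exact: (qW _ _ (set_valP c)).
have Cs c : Conf2_path R X (s (corestrict WA c)).
  by rewrite /Conf2_path /= e2s; exact: (set_valP (set_val c)).
pose p := orbit_proj (@Conf2_path_revK R X).
pose h c : Y2 R X := p (corestrict Cs c).
have ch : continuous h.
  move=> c; apply: continuous_comp; last exact: orbit_proj_continuous.
  apply: corestrict_continuous => {}c; apply: continuous_comp; last exact: cs.
  apply: corestrict_continuous => {}c.
  by apply: continuous_comp; exact: set_val_continuous.
(* Equivariance of [s] carries swapped pairs to reversed paths, which have the same class in
   [Y2]. *)
have hq c d : q (set_val c) = q (set_val d) -> h c = h d.
  move=> /orbit_projP[/val_inj->//|dc]; apply/orbit_projP; right.
  by apply/val_inj/esym/eqs; exact: (congr1 set_val dc).
have [t [ct tE]] := orbit_descent (@Conf2_swap_continuous) (oU i) ch hq.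
exists t; split => //.
have eps2t u : eps2 (t u) = set_val u.
  have [c cu] : exists c : q @^-1` (q @` W i), q (set_val c) = set_val u.
    have [c0 c0u] : exists c0, q c0 = set_val u.
      by exists (orbit_repr (set_val u)); exact: orbit_reprK.
    have Uu : (q @^-1` (q @` W i)) c0 by rewrite /= c0u; exact: (set_valP u).
    by have [c cE] := set_val_surj Uu; exists c; rewrite cE.
  rewrite (tE c u cu) eps2_proj -cu; congr q; apply: val_inj.
  by rewrite /= e2s.
(* The descended section is an honest one, so the constant homotopy works. *)
exists (fun z : (q @` W i) * I => set_val z.1).
split => // [z|u]; last by rewrite /= eps2t.
by apply: continuous_comp; [exact: cvg_fst|exact: set_val_continuous].
Qed.

End Configuration.

(** * Equivariant sections *)

Section EquivariantSections.
Context (R : realType) (X : topologicalType).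
Hypothesis hX : hausdorff_space X.
Notation I := (unit_interval R).
Notation P := (path_space R X).
Notation q := (orbit_proj (@Conf2_swapK X)).
Notation p := (orbit_proj (@Conf2_path_revK R X)).

(** The cover [p] is the pullback of [q] along [eps2]: an unoriented path with an ordering of its
    distinct end points is an oriented path. Sheets of [p] are preimages of sheets of [q], whence
    continuity. *)
Lemma double_cover_lift (Z : topologicalType) (s : Z -> Y2 R X)
    (d : Z -> Conf2 X) : continuous s -> continuous d ->
  (forall z, eps2 (s z) = q (d z)) ->
  exists g : Z -> Conf2_path R X,
    [/\ continuous g, forall z, p (g z) = s z & forall z, Conf2_e2 (g z) = d z].
Proof.
move=> cs cd sd.
have /choice[g gP] (z : Z) : exists g, p g = s z /\ Conf2_e2 g = d z.
  have [g gs] : exists g, p g = s z.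
    by exists (orbit_repr (s z)); exact: orbit_reprK.
  have := sd z; rewrite -gs eps2_proj => /orbit_projP[dg|dg].
    by exists g.
  exists (Conf2_path_rev g); split; first exact: orbit_proj_fixed.
  by rewrite Conf2_e2_rev dg.
exists g; split; [|by move=> z; exact: (gP z).1|by move=> z; exact: (gP z).2].
have cpg : continuous (fun z => p (g z)).
  by rewrite (_ : (fun z => _) = s)//; apply/funext => z; exact: (gP z).1.
move=> z; have [N nN sepN] := Conf2_separated hX (d z).
apply: (@lift_continuous_at _ _ (@Conf2_path_revK R X)
  (@Conf2_path_rev_continuous R X) _ _ _
  (@Conf2_e2 R X @^-1` N)).
- exact: cpg.
- by move=> g' /= Ng'; rewrite Conf2_e2_rev; exact: sepN.
- by apply: Conf2_e2_continuous; rewrite (gP z).2; exact: open_nbhs_nbhs.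
- have : \forall z' \near z, N (d z') by apply: cd; exact: open_nbhs_nbhs.
  by apply: filterS => z' Nd; rewrite /= (gP z').2.
Qed.

Lemma symmetric_section (U : set (Braid2 X)) (s : U -> Y2 R X) :
  open U -> continuous s ->
  homotopic R (@eps2 R X \o s) (set_val : U -> Braid2 X) ->
  exists S : q @^-1` U -> P, [/\ continuous S,
    forall v, e2 (S v) = set_val (set_val v) &
    forall v w, set_val w = Conf2_swap (set_val v) -> path_rev (S v) = S w].
Proof.
move=> oU cs [H [cH H0 H1]]; pose V : topologicalType := q @^-1` U.
have VU (v : V) : U (q (set_val v)) := set_valP v.
pose qV : V -> U := corestrict VU.
have cqV : continuous qV.
  apply: corestrict_continuous => v.
  by apply: continuous_comp; [exact: set_val_continuous|
    exact: orbit_proj_continuous].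
(* The homotopy is run backwards: it then starts at the inclusion of [U], whose lift to [V] is the
   inclusion into [Conf2]. *)
have cF : continuous (fun z : V * I => H (qV z.1, Irev z.2)).
  move=> z; apply: (@continuous_comp _ _ _
    (fun z : V * I => (qV z.1, Irev z.2))).
    apply: pair_continuous_at; apply: continuous_comp.
    - exact: cvg_fst.
    - exact: cqV.
    - exact: cvg_snd.
    - exact: Irev_continuous.
  exact: cH.
have [] := homotopy_lifting (@Conf2_swap_continuous X) (Conf2_separated hX) cF
  (@set_val_continuous _ (q @^-1` U)).
  by move=> v /=; rewrite Irev0 H1.
move=> G [cG qG G0].
have GI (v : V) t :
    continuous (fun v => G (v, t)) /\ continuous (fun t => G (v, t)).
  split=> x; apply: continuous_comp; try exact: cG; apply: pair_continuous_at;
    by [exact: cvg_id|exact: cst_continuous].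
(* The far end of [G] lies over [eps2 \o s] and thus orients the paths given by [s]. *)
have [||z|g [cg pg eg]] := @double_cover_lift V (s \o qV) (fun v => G (v, I1)).
- by move=> v; apply: continuous_comp; [exact: cqV|exact: cs].
- by move=> v; apply: (GI v I1).1.
- by rewrite qG /= Irev1 H0.
pose cl (a b : R) (t : I) := clamp (a * set_val t + b).
have ccl a b : continuous (cl a b).
  move=> t; apply: (@continuous_comp _ _ _ (fun t : I => a * set_val t + b)).
    apply: (@cvgD _ R^o _ (nbhs t) _ (fun t : I => a * set_val t) (cst b));
      last exact: cvg_cst.
    apply: (@cvgM _ _ (nbhs t) _ (cst a) (fun t : I => set_val t));
      first exact: cvg_cst.
    exact: set_val_continuous.
  exact: clamp_continuous.
(* The times [3t], [3t - 1] and [3 - 3t] run through [[0, 1]] on the successive thirds, the last one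
   backwards. *)
pose p1 (z : V * I) := (set_val (G (z.1, cl 3 0 z.2))).1.
pose p2 (z : V * I) := Defs.eval (set_val (g z.1)) (cl 3 (-1) z.2).
pose p3 (z : V * I) := (set_val (G (z.1, cl (-3) 3 z.2))).2.
have cl2 a b : continuous (fun z : V * I => cl a b z.2).
  by move=> z; apply: continuous_comp; [exact: cvg_snd|exact: ccl].
have cGcl a b : continuous (fun z : V * I => set_val (G (z.1, cl a b z.2))).
  move=> z; apply: continuous_comp; last exact: set_val_continuous.
  apply: (@continuous_comp _ _ _ (fun z : V * I => (z.1, cl a b z.2)));
    last exact: cG.
  by apply: pair_continuous_at; [exact: cvg_fst|exact: cl2].
have cp1 : continuous p1.
  move=> z; apply: (@continuous_comp _ _ _
    (fun z : V * I => set_val (G (z.1, cl 3 0 z.2))) fst).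
    exact: (cGcl 3 0).
  exact: cvg_fst.
have cp3 : continuous p3.
  move=> z; apply: (@continuous_comp _ _ _
    (fun z : V * I => set_val (G (z.1, cl (- 3) 3 z.2))) snd).
    exact: (cGcl (- 3) 3).
  exact: cvg_snd.
have cp2 : continuous p2.
  apply: eval_at_continuous; last exact: cl2.
  move=> z; apply: continuous_comp; last exact: set_val_continuous.
  by apply: continuous_comp; [exact: cvg_fst|exact: cg].
have e2g v : e2 (set_val (g v)) = set_val (G (v, I1)) := congr1 set_val (eg v).
have clI1 a b t : 1 <= a * set_val t + b -> cl a b t = I1.
  exact: clamp_ge1.
have clI0 a b t : a * set_val t + b <= 0 -> cl a b t = I0.
  exact: clamp_le0.
have [||h [ch h1 h2 h3]] := concatenate3 cp1 cp2 cp3.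
- move=> v t tE; rewrite /p1/p2/= clI1 ?clI0;
    [|by rewrite tE; lra|by rewrite tE; lra].
  by rewrite -e2g.
- move=> v t tE; rewrite /p2/p3/= !clI1;
    [|by rewrite tE; lra|by rewrite tE; lra].
  by rewrite -e2g.
have [S [cS Sh]] := continuous_to_paths ch.
exists S; split => // [v|v w wv].
  have v0 : set_val (@I0 R) = 0 by [].
  have v1 : set_val (@I1 R) = 1 by [].
  rewrite /e2 !Sh h1; last by rewrite v0; lra.
  rewrite h3; last by rewrite v1; lra.
  rewrite /p1/p3/= !clI0; [|by rewrite v1; lra|by rewrite v0; lra].
  by rewrite G0 -surjective_pairing.
have qwv : qV w = qV v.
  by apply: val_inj; rewrite /= wv; exact: orbit_proj_fixed.
(* Both sides lift the same path in [Braid2], since [qV w = qV v], and both start at [w]. *)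
have Gwv t : G (w, t) = Conf2_swap (G (v, t)).
  have := @lift_unique R _ _ (@Conf2_swapK X) (@Conf2_swap_continuous X)
    (Conf2_separated hX) (fun t => G (w, t)) (fun t => Conf2_swap (G (v, t))).
  move=> /(_ (GI w I1).2)/(_ _ _ _)/(congr1 (fun k => k t)); apply.
  - move=> u; apply: (@continuous_comp _ _ _ (fun t => G (v, t))).
      exact: (GI v I1).2.
    exact: Conf2_swap_continuous.
  - by move=> u; rewrite orbit_proj_fixed !qG /= qwv.
  - by rewrite !G0.
(* The paths [g w] and [g v] have the same class in [Y2]. Were they equal, their end points would
   form a configuration fixed by the swap. *)
have gwv : g w = Conf2_path_rev (g v).
  have : p (g w) = p (g v) by rewrite !pg /= qwv.
  move=> /orbit_projP[gvw|->]; last by rewrite Conf2_path_revK.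
  have := congr1 (@Conf2_e2 R X) gvw; rewrite !eg Gwv => /esym.
  by move/Conf2_swap_neq.
apply/val_inj/funext => t.
change (Defs.eval (S v) (Irev t) = Defs.eval (S w) t); rewrite !Sh.
have tr : set_val (Irev t) = 1 - set_val t by [].
have clr a b : cl a b (Irev t) = cl (- a) (a + b) t.
  by rewrite /cl tr; congr clamp; lra.
(* Reversal exchanges the outer thirds, as the swap exchanges the coordinates of [G], and reverses
   the middle path. *)
have [t1|t1] := leP (set_val t) (1 / 3).
  rewrite (h1 w)// h3; last by rewrite tr; lra.
  rewrite /p3/p1/= clr Gwv; congr (set_val (G (v, _))).2; congr cl; lra.
have [t2|t2] := leP (set_val t) (2 / 3).
  rewrite !h2; [|by rewrite (ltW t1)|by rewrite tr; apply/andP; split; lra].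
  rewrite /p2/= gwv clr.
  change (Defs.eval (set_val (g v)) (cl (- 3) (3 + -1) t) =
          Defs.eval (set_val (g v)) (Irev (cl 3 (-1) t))).
  congr Defs.eval; rewrite /cl.
  by rewrite -clamp_rev; congr clamp; lra.
rewrite (h3 w) ?(ltW t2)// h1; last by rewrite tr; lra.
by rewrite /p3/p1/= clr Gwv; congr (set_val (G (v, _))).1; congr cl; lra.
Qed.

End EquivariantSections.

(** * Euclidean neighbourhood retracts and the diagonal *)

Section ENR.
Context (R : realType) (X : topologicalType).
Notation I := (unit_interval R).
Notation P := (path_space R X).

Lemma ENR_embedding : is_ENR R X -> exists n (U : set 'rV[R]_n)
    (iota : X -> 'rV[R]_n) (rho : U -> X),
  [/\ open U, continuous iota, continuous rho, forall x, U (iota x)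
    & forall x (u : U), set_val u = iota x -> rho u = x].
Proof.
move=> [n [Y [[U [oU [YU [r [cr rY]]]]] [phi [psi [cphi cpsi phiK _]]]]]].
exists n, U, (set_val \o phi), (psi \o r); split => //.
- by move=> x; apply: continuous_comp; [exact: cphi|exact: set_val_continuous].
- by move=> u; apply: continuous_comp; [exact: cr|exact: cpsi].
- by move=> x; apply/YU/set_valP.
- move=> x u /= ux; rewrite -[RHS](phiK x); congr psi; apply: val_inj.
  by rewrite [LHS]rY ux//; exact: set_valP.
Qed.

Lemma ENR_hausdorff : is_ENR R X -> hausdorff_space X.
Proof.
move=> /ENR_embedding[n [U [iota [rho [_ ciota _ Uiota rhoK]]]]].
apply: (continuous_inj_hausdorff ciota); last exact: norm_hausdorff.
move=> x y xy; have [u ux] := set_val_surj (Uiota x).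
by rewrite -(rhoK x u ux); apply: rhoK; rewrite ux.
Qed.

(** The tube lemma, from compactness of the interval in its near-covering form. *)
Lemma open_forall_unit_interval (Z : topologicalType) (G : set (Z * I)) :
  open G -> open [set z | forall t, G (z, t)].
Proof.
rewrite !openE => oG z Gz.
have covI : near_covering [set: I].
  exact/compact_near_coveringP/unit_interval_compact.
suff: \forall z' \near z, [set: I] `<=` (fun t => G (z', t)).
  by apply: filterS => z' H t; exact: H.
apply: covI => t _; have [[A B] /= [Az Bt] AB] := oG _ (Gz t).
by exists (B, A) => // -[t' z'] [/= Bt' Az']; exact: AB.
Qed.

Lemma diagonal_section : is_ENR R X -> exists A : set (X * X),
  [/\ open A, symmetric_set A, forall x, A (x, x) & exists s : A -> P,
    [/\ continuous s, equivariant s & forall a, e2 (s a) = set_val a]].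
Proof.
move=> /ENR_embedding[n [U [iota [rho [oU ciota crho Uiota rhoK]]]]].
pose seg (z : (X * X) * I) : 'rV[R]_n :=
  (1 - set_val z.2) *: iota z.1.1 + set_val z.2 *: iota z.1.2.
have cseg : continuous seg.
  have cval : continuous (fun z : (X * X) * I => set_val z.2).
    by move=> z; apply: continuous_comp; [exact: cvg_snd|
      exact: set_val_continuous].
  have c1 : continuous (fun z : (X * X) * I => iota z.1.1).
    move=> z; apply: continuous_comp; last exact: ciota.
    by apply: continuous_comp; exact: cvg_fst.
  have c2 : continuous (fun z : (X * X) * I => iota z.1.2).
    move=> z; apply: continuous_comp; last exact: ciota.
    by apply: continuous_comp; [exact: cvg_fst|exact: cvg_snd].
  move=> z; apply: cvgD; apply: cvgZ; [|exact: c1|exact: cval|exact: c2].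
  by apply: cvgB; [exact: cvg_cst|exact: cval].
(* Exchanging the end points reverses the segment; both the symmetry of [A] and the equivariance of
   the section come from this. *)
have segE (a : X * X) t : seg (tau a, t) = seg (a, Irev t).
  by rewrite /seg /= subKr addrC.
have seg0 (a : X * X) : seg (a, I0) = iota a.1.
  by rewrite /seg /= subr0 scale1r scale0r addr0.
have seg1 (a : X * X) : seg (a, I1) = iota a.2.
  by rewrite /seg /= subrr scale1r scale0r add0r.
pose A : set (X * X) := [set a | forall t, U (seg (a, t))].
have tauA a : A a -> A (tau a) by move=> Aa t; rewrite segE; exact: Aa.
have UA (z : A * I) : U (seg (set_val z.1, z.2)) := set_valP z.1 z.2.
exists A; split.
- apply: (@open_forall_unit_interval _ (seg @^-1` U)).
  by move/continuousP: cseg; apply.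
- rewrite /symmetric_set eqEsubset; split=> [_ [a Aa <-]|a Aa].
    exact: tauA.
  by exists (tau a); [exact: tauA|case: (a)].
- move=> x t; rewrite /seg /= -scalerDl subrK scale1r; exact: Uiota.
(* The section sends a pair to its straight segment pushed back into [X] by [rho]. *)
have [|s [cs sE]] := @continuous_to_paths R X A (rho \o corestrict UA).
  move=> z; apply: continuous_comp; last exact: crho.
  apply: corestrict_continuous => {}z.
  apply: (@continuous_comp _ _ _ (fun z : A * I => (set_val z.1, z.2))).
    apply: pair_continuous_at; last exact: cvg_snd.
    by apply: continuous_comp; [exact: cvg_fst|exact: set_val_continuous].
  exact: cseg.
exists s; split => // [a b ba|a].
  apply/val_inj/funext => t.
  change (Defs.eval (s a) (Irev t) = Defs.eval (s b) t).
  by rewrite !sE /=; congr rho; apply: val_inj; rewrite /= ba segE.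
rewrite /e2 !sE [RHS]surjective_pairing.
by congr pair; apply: rhoK; [exact: seg0|exact: seg1].
Qed.

Lemma TCSigma_cover_genus n : is_ENR R X ->
  genus_cover R (@eps2 R X) n -> TCSigma_cover R X n.+1.
Proof.
move=> hX [U [oU coverU secU]].
have hausX := ENR_hausdorff hX.
have [D [oD symD diagD secD]] := diagonal_section hX.
pose q := orbit_proj (@Conf2_swapK X).
pose W i : set (X * X) := set_val @` (q @^-1` U i).
(* Index 0 is given to the neighbourhood [D] of the diagonal, and the other indices to the preimages
   of the [U j]. *)
exists (fun i => if unlift ord0 i is Some j then W j else D); split.
  rewrite -subTset => -[x y] _; have [<-|xy] := pselect (x = y).
    by exists ord0; rewrite ?unlift_none.
  have [c cE] := set_val_surj (xy : Conf2 X (x, y)).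
  have : setT (q c) by [].
  rewrite -coverU => -[i _ Ui]; exists (lift ord0 i) => //.
  by rewrite liftK; exists c.
move=> i; case: (unliftP ord0 i) => [j|] _; last by split.
have WC a : W j a -> Conf2 X a by move=> [c _ <-]; exact: set_valP.
split.
- apply: open_image_set_val; first exact: open_Conf2.
  exact: (oU j).
- have tauW a : W j a -> W j (tau a).
    move=> [c Uc <-]; exists (Conf2_swap c) => //.
    by rewrite /= /q orbit_proj_fixed.
  rewrite /symmetric_set eqEsubset; split=> [_ [a Wa <-]|a Wa].
    exact: tauW.
  by exists (tau a); [exact: tauW|case: (a)].
have [s [cs hs]] := secU j.
have [S [cS e2S eqS]] := symmetric_section hausX (oU j) cs hs.
have WC' (a : W j) : Conf2 X (set_val a) := WC _ (set_valP a).
have WU (a : W j) : (q @^-1` U j) (corestrict WC' a).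
  have [c Uc ca] := set_valP a.
  by rewrite (_ : corestrict WC' a = c)//; exact/val_inj/esym.
exists (S \o corestrict WU); split.
- move=> a; apply: continuous_comp; last exact: cS.
  by do 2 apply: corestrict_continuous => {}a; exact: set_val_continuous.
- by move=> a b ba; apply: eqS; apply: val_inj; rewrite /= ba.
- by move=> a; rewrite /= e2S.
Qed.

End ENR.

Local Open Scope ereal_scope.

Theorem proposition4p2 (R : realType) (X : topologicalType) (hX : is_ENR R X) :
  TC2S R X - 1 <= TCSigma R X /\ TCSigma R X <= TC2S R X.
Proof.
split.
  (* Cancelling the finite 1 is valid for an infinite genus as well; the added 0 is the shift
     [k = 0]. *)
  rewrite /TC2S addeK// -[leRHS]adde0.
  apply: (@least_index_le _ _ 0) => n.
  by rewrite addn0; exact: genus_cover_TCSigma.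
(* The shift by one accounts for the extra set around the diagonal. *)
apply: (@least_index_le _ _ 1) => n.
by rewrite addn1; exact: TCSigma_cover_genus.
Qed.
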